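(* Let $\mathcal{H}$ be a real Hilbert space and let $A,B\subseteq\mathcal{H}$ be nonempty closed and convex sets. Fix any $\alpha,\beta\in\,]0,1[$. Given $q\in\mathcal{H}$, choose any $x_0\in\mathcal{H}$ and consider the sequence defined by $$x_{n+1}=T_{A-q,B-q,\alpha,\beta}(x_n),\quad n=0,1,2,\ldots$$ If $A\cap B\neq\emptyset$ and $q-P_{A\cap B}(q)\in (N_A+N_B)\left(P_{A\cap B}(q)\right)$, then the following assertions hold: (i) the sequence $(x_n)_{n=0}^\infty$ is weakly convergent to a point $x^\star\in \operatorname{Fix} T_{A-q,B-q,\alpha,\beta}$ such that $P_A(q+x^\star)=P_{A\cap B}(q)$; (ii) the sequence $(x_{n+1}-x_n)_{n=0}^\infty$ is strongly (norm) convergent to $0$; (iii) the sequence $\left(P_A(q+x_n)\right)_{n=0}^\infty$ is strongly convergent to $P_{A\cap B}(q)$. Otherwise (that is, if $A\cap B=\emptyset$, or if $A\cap B\neq\emptyset$ but $q-P_{A\cap B}(q)\notin (N_A+N_B)(P_{A\cap B}(q))$), one has $\|x_n\|\to\infty$. Furthermore, if both $A$ and $B$ are closed affine subspaces with nonempty intersection and $q-P_{A\cap B}(q)\in(A-A)^\bot+(B-B)^\bot$, then the sequence $(x_n)_{n=0}^\infty$ is strongly convergent to $P_{\operatorname{Fix} T_{A-q,B-q,\alpha,\beta}}(x_0)$.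
   Context: $I$ is the identity mapping on $\mathcal{H}$. For a nonempty closed convex set $C\subseteq\mathcal{H}$, $P_C$ denotes the projector (nearest point map) onto $C$. For nonempty closed convex sets $A,B\subseteq\mathcal{H}$ and $\alpha,\beta\in\,]0,1[$, the averaged alternating modified reflections (AAMR) operator $T_{A,B,\alpha,\beta}:\mathcal{H}\to\mathcal{H}$ is $$T_{A,B,\alpha,\beta}:=(1-\alpha)I+\alpha(2\beta P_B-I)(2\beta P_A-I),$$ where juxtaposition means composition. $A-q=\{a-q\mid a\in A\}$ and $A-A=\{a-a'\mid a,a'\in A\}$. $\operatorname{Fix}T=\{x\in\mathcal{H}\mid T(x)=x\}$. For a convex set $C$, the normal cone is $N_C(x)=\{u\in\mathcal{H}\mid\langle u,c-x\rangle\leq 0\ \forall c\in C\}$ if $x\in C$ and $N_C(x)=\emptyset$ otherwise; $(N_A+N_B)(x)=N_A(x)+N_B(x)$ (Minkowski sum). $S^\bot=\{x\in\mathcal{H}\mid\langle s,x\rangle=0\ \forall s\in S\}$. *)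

(* Defs.v *)
From HB Require Import structures.
From mathcomp Require Import all_boot all_order all_algebra sesquilinear.
From mathcomp Require Import all_classical all_reals all_analysis.

Set Implicit Arguments.
Unset Strict Implicit.
Unset Printing Implicit Defensive.

Import Order.TTheory GRing.Theory Num.Theory.
Import numFieldNormedType.Exports.

Local Open Scope classical_set_scope.
Local Open Scope ring_scope.

(* A real Hilbert space is a complete normed module [H] over [R : realType]
   with a symmetric bilinear form [dot] that induces the norm of [H]. *)
Definition norm_induced_by (R : realType) (H : completeNormedModType R)
    (dot : {dot H for idfun}) : Prop :=
  forall x : H, `|x| ^+ 2 = dot x x.

Definition affine_set (R : realType) (H : lmodType R) (C : set H) : Prop :=
  forall (x y : H) (t : R), C x -> C y -> C ((1 - t) *: x + t *: y).

(* The nearest point exists and is unique when [C] is a nonempty closed convex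
   subset of a Hilbert space; where no nearest point exists the value is 0. *)
Definition projector (R : realType) (H : normedModType R) (C : set H) (x : H) : H :=
  xget 0 [set p | C p /\ forall c, C c -> `|x - p| <= `|x - c|].

Definition translate (R : realType) (H : lmodType R) (C : set H) (q : H)
    : set H :=
  [set c - q | c in C].

Definition mink_sum (R : realType) (H : lmodType R) (C D : set H) : set H :=
  [set c + d | c in C & d in D].

Definition mink_diff (R : realType) (H : lmodType R) (C D : set H) : set H :=
  [set c - d | c in C & d in D].

Definition modified_reflector (R : realType) (H : normedModType R)
    (C : set H) (beta : R) (x : H) : H :=
  (2 * beta) *: projector C x - x.

Definition aamr (R : realType) (H : normedModType R) (A B : set H)
    (alpha beta : R) (x : H) : H :=
  (1 - alpha) *: x
  + alpha *: modified_reflector B beta (modified_reflector A beta x).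

Definition fixpoints (T : Type) (f : T -> T) : set T := [set x | f x = x].

Definition normal_cone (R : realType) (H : lmodType R)
    (dot : {dot H for idfun}) (C : set H) (x : H) : set H :=
  [set u | C x /\ forall c, C c -> dot u (c - x) <= 0].

Definition orthogonal_complement (R : realType) (H : lmodType R)
    (dot : {dot H for idfun}) (S : set H) : set H :=
  [set x | forall s, S s -> dot s x = 0].

Definition weakly_cvg (R : realType) (H : lmodType R)
    (dot : {dot H for idfun}) (x : nat -> H) (l : H) : Prop :=
  forall u : H, dot (x n) u @[n --> \oo] --> dot l u.

(* Main.v *)
(* The reflectors [2 beta P_C - 1] are nonexpansive, with a surplus proportional to
   [|P_C u - P_C v|^2], so [T] is averaged and [P_A] converges strongly along its orbits as
   soon as [T] has a fixed point. A fixed point [z] of [T] yields a point [p = P_A (q + z)] of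
   [A `&` B] where [q - p] splits into normal vectors of [A] and [B]; conversely such a
   splitting gives a fixed point. Thus the qualification condition means that [T] has a fixed
   point.

   For an averaged map with a fixed point, orbits are Fejer monotone and asymptotically regular;
   demiclosedness and Opial's argument give weak convergence. Weak cluster points are produced
   as weak limits along ultrafilters: on a bounded sequence [u |-> lim <x n, u>] is a bounded
   linear form, represented by Riesz. Without fixed points, either the step lengths stay away
   from [0] and the orbit drifts to infinity at linear speed, or they vanish, and a bounded
   subsequence would have a fixed weak cluster point.

   If [A] and [B] are affine, so is [T]; then the vectors on which the iterates of its linear
   part tend to [0] form a closed subspace containing everything orthogonal to its fixed vectors. *)
Require Import Defs.
From mathcomp Require Import all_boot all_order all_algebra sesquilinear.
From mathcomp Require Import all_classical all_reals all_analysis.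
From mathcomp Require Import ring lra.

Set Implicit Arguments.
Unset Strict Implicit.
Unset Printing Implicit Defensive.

Import Order.TTheory GRing.Theory Num.Theory.
Import numFieldNormedType.Exports.

Local Open Scope classical_set_scope.
Local Open Scope ring_scope.

(** * Projections and representation of linear forms *)

Section InnerProduct.
Context (R : realType) (H : completeNormedModType R).
Context (dot : {dot H for idfun}) (dot_norm : norm_induced_by dot).
Implicit Types (u v w x y z : H) (a t : R).

Lemma dotC u v : dot u v = dot v u.
Proof. by rewrite hermC expr0 mul1r. Qed.

Lemma dotDl u v w : dot (u + v) w = dot u w + dot v w.
Proof. by rewrite linearDl. Qed.

Lemma dotNl u w : dot (- u) w = - dot u w.
Proof. by rewrite linearNl. Qed.

Lemma dotZl a u w : dot (a *: u) w = a * dot u w.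
Proof. by rewrite linearZl_LR. Qed.

Lemma dotDr u v w : dot u (v + w) = dot u v + dot u w.
Proof. by rewrite !(dotC u) dotDl. Qed.

Lemma dotNr u w : dot u (- w) = - dot u w.
Proof. by rewrite !(dotC u) dotNl. Qed.

Lemma dotZr a u w : dot u (a *: w) = a * dot u w.
Proof. by rewrite !(dotC u) dotZl. Qed.

Lemma dot0l u : dot 0 u = 0.
Proof. by rewrite -(scale0r 0) dotZl mul0r. Qed.

Lemma dot0r u : dot u 0 = 0.
Proof. by rewrite dotC dot0l. Qed.

Definition dotE := (dotDl, dotDr, dotNl, dotNr, dotZl, dotZr).

Lemma dot_ge0 u : 0 <= dot u u.
Proof. by rewrite -dot_norm sqr_ge0. Qed.

Lemma dot_eq0 u : dot u u = 0 -> u = 0.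
Proof. by rewrite -dot_norm => /eqP; rewrite sqrf_eq0 normr_eq0 => /eqP. Qed.

(* Reduces identities between vectors to identities between scalars, which [ring] decides. *)
Lemma dot_inj u v : (forall w, dot u w = dot v w) -> u = v.
Proof.
move=> uv; apply/eqP; rewrite -subr_eq0; apply/eqP/dot_eq0.
by rewrite dotDl dotNl uv subrr.
Qed.

Lemma ler_norm_dot u v : (`|u| <= `|v|) = (dot u u <= dot v v).
Proof. by rewrite -!dot_norm ler_sqr ?nnegrE. Qed.

Lemma cauchy_schwarz u v : `|dot u v| <= `|u| * `|v|.
Proof.
rewrite -ler_sqr ?nnegrE ?mulr_ge0// exprMn !dot_norm real_normK ?num_real//.
have [->|v0] := eqVneq v 0; first by rewrite !dot0r mulr0 expr0n.
have vv : 0 < dot v v by rewrite -dot_norm exprn_gt0// normr_gt0.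
have := dot_ge0 (dot v v *: u - dot u v *: v).
rewrite !dotE (dotC v u) => h.
have {h} : 0 <= dot v v * (dot u u * dot v v - dot u v ^+ 2).
  by apply: le_trans h _; rewrite le_eqVlt; apply/orP; left; apply/eqP; ring.
by rewrite pmulr_rge0// subr_ge0.
Qed.

Lemma convex_mem (C : set H) u v t : convex_set C -> C u -> C v ->
  0 <= t <= 1 -> C (t *: u + (1 - t) *: v).
Proof.
move=> cC Cu Cv /andP[t0 t1].
have /set_mem := cC u v (Itv01 t0 t1) (mem_set Cu) (mem_set Cv).
by [].
Qed.

(** A minimizing sequence is Cauchy: by convexity the midpoint of two of its terms is no closer to
    [x] than the infimum, so the parallelogram law bounds their distance. Completeness and
    closedness give the limit. *)
Lemma nearest_point (C : set H) x : C !=set0 -> closed C -> convex_set C ->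
  exists2 p, C p & forall c, C c -> `|x - p| <= `|x - c|.
Proof.
move=> [c0 Cc0] clC cC.
set D := [set dot (x - c) (x - c) | c in C].
have infD : has_inf D.
  by split; [exists (dot (x - c0) (x - c0)), c0 | exists 0 => _ [c _ <-]; exact: dot_ge0].
have infle c : C c -> inf D <= dot (x - c) (x - c).
  by move=> Cc; apply: ge_inf; [exact: infD.2|exists c].
have /choice[c hc] : forall n : nat, exists c,
    C c /\ dot (x - c) (x - c) < inf D + n.+1%:R^-1.
  move=> n; have n0 : (0 : R) < n.+1%:R^-1 by rewrite invr_gt0.
  by have [_ [c Cc <-] lt] := inf_adherent n0 infD; exists c.
have par m n : `|c m - c n| ^+ 2 <= 2 * (m.+1%:R^-1 + n.+1%:R^-1).
  have h := convex_mem (t := 2^-1) cC (hc m).1 (hc n).1.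
  have {}h : C (2^-1 *: c m + (1 - 2^-1) *: c n) by apply: h; lra.
  move/infle: h; have [_ ] := hc m; have [_] := hc n.
  rewrite dot_norm !dotE (dotC (c n) (c m)) !(dotC (c _) x).
  by move: (m.+1%:R^-1) (n.+1%:R^-1) (inf D) => a b d; lra.
have /cauchy_cvg/cvg_ex[p cp] : cauchy (c @ \oo).
  apply: cauchy_exP => e e0.
  have e4 : 0 < e ^+ 2 / 4 by rewrite divr_gt0// exprn_gt0.
  have [N _ HN] := near_infty_natSinv_lt (PosNum e4).
  exists (c N); exists N => // n /= Nn.
  rewrite -ball_normE /= -(@ltr_pXn2r _ 2) ?nnegrE ?(ltW e0)//.
  apply: le_lt_trans (par _ _) _.
  have /= := HN n Nn; have /= := HN N (leqnn N).
  by move: (N.+1%:R^-1) (n.+1%:R^-1) => a b; lra.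
exists p; first by apply: (closed_cvg _ clC _ _ cp); near=> n; exact: (hc n).1.
move=> y Cy; rewrite ler_norm_dot; apply: le_trans (infle _ Cy).
rewrite -dot_norm.
have lim1 : `|x - c n| ^+ 2 @[n --> \oo] --> `|x - p| ^+ 2.
  by apply: cvgM; apply: cvg_norm; apply: cvgB => //; exact: cvg_cst.
have lim2 : inf D + n.+1%:R^-1 @[n --> \oo] --> inf D.
  by rewrite -[X in _ --> X]addr0; apply: cvgD; [exact: cvg_cst|exact: cvg_harmonic].
apply: ler_cvg_to lim1 lim2 _; near=> n.
by rewrite dot_norm ltW//; exact: (hc n).2.
Unshelve. all: by end_near. Qed.

Lemma nearest_obtuse (C : set H) x p : convex_set C -> C p ->
  (forall c, C c -> `|x - p| <= `|x - c|) ->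
  forall c, C c -> dot (x - p) (c - p) <= 0.
Proof.
move=> cC Cp pmin c Cc; rewrite leNgt; apply/negP => D0.
set D := dot _ _ in D0; set N := dot (c - p) (c - p).
have N0 : 0 <= N by exact: dot_ge0.
have DN : 0 < N + D by lra.
(* A short move from [p] towards [c] changes the squared distance by [t * (t * N - 2 * D)]. This [t]
   lies in ]0,1] even if [N = 0] and satisfies [t * N <= D], so the change is negative. *)
set t := D / (N + D).
have t01 : 0 <= t <= 1.
  by rewrite divr_ge0 ?(ltW DN) ?(ltW D0)//= ler_pdivrMr//; lra.
have tD : t * (N + D) = D by rewrite /t divfK// gt_eqF.
have := pmin _ (convex_mem cC Cc Cp t01).
have -> : x - (t *: c + (1 - t) *: p) = (x - p) - t *: (c - p).
  by rewrite scalerBl scale1r scalerBr !opprD !opprK !addrA; congr (_ + _); rewrite addrAC.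
rewrite ler_norm_dot; move: (x - p) (c - p) @D @N => e d D N in t D0 N0 DN t01 tD *.
rewrite !dotE (dotC d e) -/D -/N.
have t0 : 0 < t by rewrite divr_gt0.
suff : 0 < t * (2 * D - t * N) by nra.
rewrite mulr_gt0//; nra.
Qed.

Lemma obtuse_dist (C : set H) x p :
  (forall c, C c -> dot (x - p) (c - p) <= 0) ->
  forall c, C c -> `|x - p| ^+ 2 + `|c - p| ^+ 2 <= `|x - c| ^+ 2.
Proof.
move=> ob c Cc; have := ob c Cc; have -> : x - c = (x - p) - (c - p).
  by rewrite opprB addrC subrKA addrC.
by rewrite !dot_norm; move: (x - p) (c - p) => u v; rewrite !dotE (dotC v u); lra.
Qed.

(** A nearest point exists, so [xget] returns one and never its default 0. With [projector_unique]
    this is the variational characterization through which projections are handled below. *)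
Lemma projector_spec (C : set H) x : C !=set0 -> closed C -> convex_set C ->
  C (projector C x) /\ forall c, C c -> dot (x - projector C x) (c - projector C x) <= 0.
Proof.
move=> C0 clC cC; have [p Cp pmin] := nearest_point x C0 clC cC.
have /= [Cq qmin] := xgetPex 0 (ex_intro
  [set p | C p /\ forall c, C c -> `|x - p| <= `|x - c|] p (conj Cp pmin)).
by split=> // c; exact: nearest_obtuse.
Qed.

Lemma projector_unique (C : set H) x p : C p ->
  (forall c, C c -> dot (x - p) (c - p) <= 0) -> projector C x = p.
Proof.
move=> Cp ob; have dist := obtuse_dist ob.
apply: xget_unique.
  split=> // c Cc; rewrite -ler_sqr ?nnegrE//.
  by apply: le_trans (dist c Cc); rewrite lerDl sqr_ge0.
move=> r [Cr rmin]; apply/eqP; rewrite -subr_eq0 -normr_eq0 -sqrf_eq0.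
have := rmin p Cp; rewrite -ler_sqr ?nnegrE//; have := dist r Cr.
by rewrite eq_le sqr_ge0 andbT; lra.
Qed.

(* The representer is found on the hyperplane [f = 1], as its point closest to the origin. *)
Lemma riesz (f : H -> R) (M : R) :
  (forall u v, f (u + v) = f u + f v) -> (forall a u, f (a *: u) = a * f u) ->
  (forall u, `|f u| <= M * `|u|) -> exists l, forall u, f u = dot l u.
Proof.
move=> fD fZ fM.
have [[u0 fu0]|f0] := pselect (exists u, f u != 0); last first.
  exists 0 => u; rewrite dot0l; apply: contrapT => /eqP fu; apply: f0; by exists u.
have fN u : f (- u) = - f u by rewrite -scaleN1r fZ mulN1r.
pose C := [set u | f u = 1].
have cf : continuous f.
  move=> u; apply/cvgrPdist_lt => e e0.
  have M0 : 0 < `|M| + 1 by rewrite ltr_wpDl.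
  near=> v; rewrite -fN -fD; apply: le_lt_trans (fM _) _.
  apply: (@le_lt_trans _ _ ((`|M| + 1) * `|u - v|)).
    by rewrite ler_wpM2r//; have := ler_norm M; lra.
  rewrite mulrC -ltr_pdivlMr//; near: v.
  by apply: cvgr_dist_lt; [exact: cvg_id|rewrite divr_gt0].
have C0 : C !=set0 by exists ((f u0)^-1 *: u0); rewrite /C/= fZ mulVf.
have clC : closed C.
  rewrite (_ : C = f @^-1` [set 1])//; apply: preimage_closed => [x _|]; first exact: cf.
  exact: closed_eq.
have cC : convex_set C.
  move=> u v k; rewrite !inE /C/= => fu fv.
  rewrite /conv/= fD !fZ fu fv !mulr1; exact: subrKC.
have [Cp ob] := projector_spec 0 C0 clC cC.
move: (projector C 0) Cp ob => p fp ob.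
(* The hyperplane contains [p + t *: h] for every real [t], so the obtuse angle inequality holds for
   both signs of [t]. *)
have ker h : f h = 0 -> dot p h = 0.
  move=> fh.
  have ge t : 0 <= t * dot p h.
    have : C (p + t *: h) by rewrite /C/= fD fZ fh mulr0 addr0 fp.
    by move/ob; rewrite addrAC subrr !add0r !dotE; lra.
  by have := ge 1; have := ge (-1); lra.
have p0 : dot p p != 0.
  apply/eqP => /dot_eq0 p0; have := fp; rewrite /C/= p0 -(scale0r 0) fZ mul0r.
  by move/eqP; rewrite eq_sym oner_eq0.
exists ((dot p p)^-1 *: p) => u; rewrite dotZl.
have := ker (u - f u *: p); rewrite fD fN fZ fp mulr1 subrr => /(_ erefl).
rewrite !dotE => /eqP; rewrite subr_eq0 => /eqP ->.
by rewrite mulrC mulfK.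
Unshelve. all: by end_near. Qed.

End InnerProduct.

(** * Averaged maps *)

Lemma eq_cvg_to (S T : Type) (F : set_system S) (f g : S -> T) (G : set_system T) :
  f =1 g -> f @ F --> G -> g @ F --> G.
Proof. by move=> /funext->. Qed.

(** The tails restricted to [P] generate a proper filter, which extends to an ultrafilter. It plays
    the role of a subsequence inside [P]. *)
Lemma ultra_frequently (P : set nat) : ~ (\forall n \near \oo, ~ P n) ->
  exists F : set_system nat, [/\ UltraFilter F, F --> \oo & \forall n \near F, P n].
Proof.
move=> freq.
have PF : ProperFilter (within P \oo).
  by split; [move=> W; apply: freq; exact: W|exact: within_filter].
have [F [UF sF]] := ultraFilterLemma PF.
exists F; split=> //; last by apply: sF; exact: withinT.
by apply: subset_trans sF; exact: cvg_within.
Qed.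

Lemma ultra_fmap (S T : Type) (f : S -> T) (F : set_system S) :
  UltraFilter F -> UltraFilter (f @ F).
Proof.
move=> UF; split=> [|G GP sG]; first exact: fmap_proper_filter.
rewrite eqEsubset; split=> // A GA.
have [//|FnA] := in_ultra_setVsetC (f @^-1` A) UF.
have /sG GnA : (f @ F) (~` A) by [].
by have /filter_ex[? []] : G (A `&` ~` A) by exact: filterI.
Qed.

Lemma ultra_bounded_cvg (R : realType) (T : Type) (f : T -> R) (F : set_system T) (M : R) :
  UltraFilter F -> (\forall t \near F, `|f t| <= M) -> exists l : R, f @ F --> l.
Proof.
move=> UF FM; have := @segment_compact R (- M) M; rewrite compact_ultra => K.
have [|l [_ fl]] := K (f @ F) (ultra_fmap f UF); last by exists l.
by rewrite /fmap/=; apply: filterS FM => t; rewrite /= in_itv/= ler_norml.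
Qed.

Lemma decrement_cvg0 (R : realType) (a b : nat -> R) : (forall n, 0 <= a n) ->
  (forall n, 0 <= b n) -> (forall n, a n.+1 + b n <= a n) ->
  cvgn a /\ b @ \oo --> 0.
Proof.
move=> a0 b0 ab; have ca : cvgn a.
  apply: nonincreasing_is_cvgn; last by exists 0 => _ [n _ <-].
  by apply/nonincreasing_seqP => n; have := ab n; have := b0 n; lra.
split=> //; have ca1 : a n.+1 @[n --> \oo] --> limn a.
  by rewrite (cvg_shiftS a).
apply: (@squeeze_cvgr _ _ _ _ (fun=> 0) (fun n => a n - a n.+1)).
- by near=> n; rewrite b0/=; have := ab n; lra.
- exact: cvg_cst.
- by rewrite -(subrr (limn a)); exact: cvgB.
Unshelve. all: by end_near. Qed.

Lemma norm_sqr_cvg0 (R : realType) (V : normedModType R) (u : nat -> V) :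
  `|u n| ^+ 2 @[n --> \oo] --> 0 -> u @ \oo --> 0.
Proof.
move=> /cvgr0Pnorm_lt lim; apply/cvgr0Pnorm_lt => e e0.
have := lim _ (exprn_gt0 2 e0); apply: filterS => n.
by rewrite normrX normr_id ltr_pXn2r ?nnegrE ?(ltW e0).
Qed.

Lemma decrement_norm_cvg0 (R : realType) (V : normedModType R) (m : R) (a : nat -> R)
    (u : nat -> V) : 0 < m -> (forall n, 0 <= a n) ->
  (forall n, a n.+1 + m * `|u n| ^+ 2 <= a n) -> u @ \oo --> 0.
Proof.
move=> m0 a0 au; have [|_ lim] := decrement_cvg0 a0 _ au.
  by move=> n; rewrite mulr_ge0 ?sqr_ge0 ?ltW.
apply: norm_sqr_cvg0.
rewrite -(mulr0 m^-1); apply: eq_cvg_to (cvgM (cvg_cst m^-1) lim) => n.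
by rewrite /GRing.mul_fun/= mulrA mulVf ?mul1r// gt_eqF.
Qed.

Section Averaged.
Context (R : realType) (H : completeNormedModType R).
Context (dot : {dot H for idfun}) (dot_norm : norm_induced_by dot).

(** For [k = (1 - alpha) / alpha] with [alpha] in ]0,1[ this characterizes the maps
    [(1 - alpha) I + alpha N] with [N] nonexpansive. *)
Definition averaged (k : R) (T : H -> H) := forall u v,
  `|T u - T v| ^+ 2 + k * `|(u - T u) - (v - T v)| ^+ 2 <= `|u - v| ^+ 2.

Lemma ultra_weak_limit (F : set_system nat) (x : nat -> H) (M : R) :
  UltraFilter F -> (\forall n \near F, `|x n| <= M) ->
  exists l, forall u, dot (x n) u @[n --> F] --> dot l u.
Proof.
move=> UF xM.
have bnd u : \forall n \near F, `|dot (x n) u| <= M * `|u|.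
  near=> n; apply: le_trans (cauchy_schwarz dot_norm _ _) _.
  by rewrite ler_wpM2r//; near: n.
have /choice[f fE] u : exists r : R, dot (x n) u @[n --> F] --> r.
  exact: ultra_bounded_cvg (bnd u).
have uniq := @cvg_unique _ (@Rhausdorff R).
have [u v|a u|u|l lE] := @riesz _ _ _ dot_norm f M.
- apply: uniq (fE _) _ => /=; under eq_cvg do rewrite dotDr; exact: cvgD.
- apply: uniq (fE _) _ => /=; under eq_cvg do rewrite dotZr; apply: cvgM => //; exact: cvg_cst.
- have := cvg_cst (M * `|u|); move/(_ nat F) => cM.
  exact: (ler_cvg_to (cvg_norm (fE u)) (cM _) (bnd u)).
- by exists l => u; rewrite -lE.
Unshelve. all: by end_near. Qed.

(** Put [d = l - T l] and [e n = |x n - T (x n)|]. Expanding [|x n - T l|^2] around [l] and bounding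
    [|x n - T l|] by [e n + |x n - l|] gives [|d|^2 <= e n^2 + 2 e n |x n - l| - 2 <x n - l, d>],
    whose right side tends to 0. *)
Lemma demiclosed (F : set_system nat) (T : H -> H) (x : nat -> H) (l : H) (M : R) :
  ProperFilter F -> (forall u v, `|T u - T v| <= `|u - v|) ->
  (\forall n \near F, `|x n| <= M) ->
  (forall u, dot (x n) u @[n --> F] --> dot l u) ->
  `|x n - T (x n)| @[n --> F] --> 0 -> T l = l.
Proof.
move=> PF nexp xM xl reg.
apply/esym/eqP; rewrite -subr_eq0 -normr_eq0 -sqrf_eq0 eq_le sqr_ge0 andbT.
set e := fun n => `|x n - T (x n)| in reg.
have [d dE] : exists d, d = l - T l by exists (l - T l).
rewrite -dE.
have lim : e n ^+ 2 + 2 * e n * (M + `|l|) - 2 * (dot (x n) d - dot l d) @[n --> F] --> (0 : R).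
  rewrite (_ : 0 = 0 * 0 + 2 * 0 * (M + `|l|) - 2 * (dot l d - dot l d)); last by ring.
  apply: cvgB; first apply: cvgD.
  - by apply: cvgM.
  - by apply: cvgM; [apply: cvgM => //|]; exact: cvg_cst.
  - by apply: cvgM; [exact: cvg_cst|apply: cvgB => //; exact: cvg_cst].
apply: (ler_cvg_to (cvg_cst _) lim); near=> n.
have xnM : `|x n| <= M by near: n.
have xnl : `|x n - l| <= M + `|l| by apply: le_trans (ler_normB _ _) _; rewrite lerD2r.
have e0 : 0 <= e n by exact: normr_ge0.
have : `|x n - T l| <= e n + `|x n - l|.
  by rewrite -(subrKA (T (x n))); apply: le_trans (ler_normD _ _) _; rewrite lerD2l.
rewrite -ler_sqr ?nnegrE ?addr_ge0// -(subrKA l (x n)) -dE sqrrD.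
have -> : `|x n - l + d| ^+ 2 = `|x n - l| ^+ 2 + 2 * (dot (x n) d - dot l d) + `|d| ^+ 2.
  by rewrite !dot_norm !dotE (dotC _ l (x n)) (dotC _ d (x n)) (dotC _ d l); ring.
move: xnl e0; move: `|x n - l| (M + `|l|) (e n) => y m s.
rewrite -mulr_natr.
move=> ym s0; have : s * y <= s * m by rewrite ler_wpM2l.
lra.
Unshelve. all: by end_near. Qed.

(** * Orbits of an averaged map *)

Section Orbit.
Context (k : R) (k0 : 0 < k) (T : H -> H) (avgT : averaged k T).
Context (x : nat -> H) (xS : forall n, x n.+1 = T (x n)).

Lemma averaged_nonexpansive u v : `|T u - T v| <= `|u - v|.
Proof.
rewrite -ler_sqr ?nnegrE//; apply: le_trans (avgT u v).
by rewrite lerDl mulr_ge0 ?sqr_ge0 ?ltW.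
Qed.

(** The squared distance between the orbits drops each time by at least [k] times the squared
    difference of their steps. A shift of [x] as [y] compares successive steps; a constant orbit as
    [y] gives asymptotic regularity. *)
Lemma gap_cvg0 (y : nat -> H) : (forall n, y n.+1 = T (y n)) ->
  (x n - x n.+1) - (y n - y n.+1) @[n --> \oo] --> (0 : H).
Proof.
move=> yS.
apply: (decrement_norm_cvg0 (a := fun n => `|x n - y n| ^+ 2) k0) => n; first exact: sqr_ge0.
by rewrite !xS !yS; exact: avgT.
Qed.

(* Were the step lengths to stay above [d > 0], consecutive steps would become asymptotically
   equal, so that [x n - x (n + j)] would be about [j] steps long for large [n]; this
   distance decreases in [n], which makes it at least [j * d] already for [n = 0]. *)
Lemma drift (d : R) j : (forall n, d <= `|x n - x n.+1|) -> j%:R * d <= `|x 0 - x j|.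
Proof.
move=> dx.
have nonincr n : `|x n - x (n + j)%N| <= `|x 0 - x j|.
  elim: n => [|n]; first by rewrite add0n.
  by apply: le_trans; rewrite addSn !xS; exact: averaged_nonexpansive.
have lim : (x n - x (n + j)%N) - j%:R *: (x n - x n.+1) @[n --> \oo] --> (0 : H).
  elim: j {nonincr} => [|j IH].
    under eq_cvg do rewrite addn0 subrr scale0r subr0; exact: cvg_cst.
  have gap := @gap_cvg0 (fun n => x (n + j)%N) (fun n => xS (n + j)%N).
  have {IH gap} := @cvgB _ _ _ _ eventually_filter _ _ _ _ IH gap.
  rewrite subr0; apply: eq_cvg_to => n /=.
  rewrite -natr1 scalerDl scale1r addnS /=.
  by apply: (dot_inj dot_norm) => w; rewrite !dotE; ring.
have {}lim : `|x 0 - x j| + `|(x n - x (n + j)%N) - j%:R *: (x n - x n.+1)|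
    @[n --> \oo] --> `|x 0 - x j|.
  rewrite -[X in _ --> X]addr0; apply: cvgD; first exact: cvg_cst.
  by rewrite -(normr0 H); exact: cvg_norm.
apply: ler_cvg_to (cvg_cst _) lim _; near=> n => /=.
apply: (@le_trans _ _ (j%:R * `|x n - x n.+1|)); first by rewrite ler_wpM2l.
rewrite -[X in X * _](@ger0_norm _ j%:R)// -normrZ.
set s := j%:R *: _; set r := x n - x (n + j)%N.
apply: (@le_trans _ _ (`|r| + `|r - s|)); last by rewrite lerD2r; exact: nonincr.
by rewrite -{1}(subKr r s); exact: ler_normB.
Unshelve. all: by end_near. Qed.

Lemma ultra_weak_fixed (F : set_system nat) (M : R) :
  UltraFilter F -> F --> \oo -> (\forall n \near F, `|x n| <= M) ->
  `|x n - x n.+1| @[n --> \oo] --> 0 ->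
  exists2 l, T l = l & forall u, dot (x n) u @[n --> F] --> dot l u.
Proof.
move=> UF FN FM reg; have [l xl] := ultra_weak_limit UF FM.
exists l => //; apply: (demiclosed _ averaged_nonexpansive FM xl).
under eq_cvg do rewrite -xS; exact: cvg_trans (cvg_app _ FN) reg.
Qed.

Lemma averaged_fixed_or_escape : (forall z, T z <> z) -> `|x n| @[n --> \oo] --> +oo.
Proof.
move=> nofix.
have step0 n : 0 <= `|x n - x n.+1| by exact: normr_ge0.
have stepS : nonincreasing_seq (fun n => `|x n - x n.+1|).
  apply/nonincreasing_seqP => n.
  by rewrite [x n.+2]xS {1}[x n.+1]xS; exact: averaged_nonexpansive.
have cd : cvgn (fun n => `|x n - x n.+1|).
  by apply: nonincreasing_is_cvgn => //; exists 0 => _ [n _ <-].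
have := nonincreasing_cvgn_ge stepS cd; set d := limn _ => dle.
have : 0 <= d by apply: limr_ge => //; near=> n.
(* If [d > 0], [drift] forces linear growth. If [d = 0] and the norms did not tend to infinity, they
   would be bounded along an ultrafilter, whose weak limit would be fixed. *)
rewrite le_eqVlt => /orP[/eqP d0|d0]; last first.
  apply/cvgryPge => M; near=> n.
  have := drift n dle; have := ler_normB (x 0) (x n).
  suff : M + `|x 0| <= n%:R * d by lra.
  rewrite -ler_pdivrMr//; near: n; exact: nbhs_infty_ger.
apply/cvgryPge => M; apply: contrapT => freq.
have [|F [UF FN FM]] := @ultra_frequently (fun n => `|x n| <= M).
  move=> W; apply: freq; apply: filterS W => n /negP; rewrite -ltNge; exact: ltW.
have [|l fl _] := ultra_weak_fixed UF FN FM; first by rewrite d0; exact: cd.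
exact: nofix fl.
Unshelve. all: by end_near. Qed.

Section FixedPoint.
Context (z : H) (Tz : T z = z).

Lemma averaged_fejer : cvgn (fun n => `|x n - z| ^+ 2) /\ x n - x n.+1 @[n --> \oo] --> (0 : H).
Proof.
split; last by have := @gap_cvg0 (fun=> z) (fun=> esym Tz); under eq_cvg do rewrite subrr subr0.
apply: (@decrement_cvg0 _ _ (fun=> 0) _ _ _).1 => [n|//|n]; first exact: sqr_ge0.
rewrite addr0 xS ler_sqr ?nnegrE// -{1}Tz; exact: averaged_nonexpansive.
Qed.

Lemma averaged_bounded n : `|x n| <= `|x 0 - z| + `|z|.
Proof.
apply: (@le_trans _ _ (`|x n - z| + `|z|)).
  by rewrite -{1}(subrK z (x n)) ler_normD.
rewrite lerD2r; elim: n => // n; apply: le_trans.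
by rewrite xS -{1}Tz; exact: averaged_nonexpansive.
Qed.

End FixedPoint.

(* Opial: [dot (x n) (l - m)] converges along the full sequence whenever [l] and [m] are
   fixed, so two weak limits along ultrafilters coincide. *)
Lemma averaged_weak_cvg z : T z = z -> exists2 l, T l = l & weakly_cvg dot x l.
Proof.
move=> Tz; have [_ reg] := averaged_fejer Tz.
have {}reg : `|x n - x n.+1| @[n --> \oo] --> 0 by rewrite -(normr0 H); exact: cvg_norm.
have wk (F : set_system nat) : UltraFilter F -> F --> \oo ->
    exists2 l, T l = l & forall u, dot (x n) u @[n --> F] --> dot l u.
  move=> UF FN; apply: (ultra_weak_fixed UF FN _ reg).
  by near=> n; exact: averaged_bounded Tz n.
have uniq (F G : set_system nat) l m : ProperFilter F -> ProperFilter G ->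
    F --> \oo -> G --> \oo -> T l = l -> T m = m ->
    (forall u, dot (x n) u @[n --> F] --> dot l u) ->
    (forall u, dot (x n) u @[n --> G] --> dot m u) -> l = m.
  move=> PF PG FN GN fl fm xl xm.
  have [c xc] : exists c : R, dot (x n) (l - m) @[n --> \oo] --> c.
    have [cl _] := averaged_fejer fl; have [cm _] := averaged_fejer fm.
    (* Polarization: [2 <x n, l - m> = |x n - m|^2 - |x n - l|^2 + |l|^2 - |m|^2], and both
       distances converge by Fejer monotonicity. *)
    exists (2^-1 * (limn (fun n => `|x n - m| ^+ 2) - limn (fun n => `|x n - l| ^+ 2)
      + (dot l l - dot m m))).
    apply: (@eq_cvg_to _ _ _ (fun n => 2^-1 * (`|x n - m| ^+ 2 - `|x n - l| ^+ 2
      + (dot l l - dot m m)))) => [n|]; last first.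
      apply: cvgM; first exact: cvg_cst.
      by apply: cvgD; [exact: cvgB|exact: cvg_cst].
    rewrite !dot_norm !dotE (dotC _ l (x n)) (dotC _ m (x n)).
    by field.
  have e1 : dot l (l - m) = c by exact: (cvg_unique _ (xl _) (cvg_trans (cvg_app _ FN) xc)).
  have e2 : dot m (l - m) = c by exact: (cvg_unique _ (xm _) (cvg_trans (cvg_app _ GN) xc)).
  apply/eqP; rewrite -subr_eq0; apply/eqP/(dot_eq0 dot_norm).
  by rewrite dotDl dotNl e1 e2 subrr.
have [F0 [UF0 oo0]] := ultraFilterLemma eventually_filter.
have [l fl xl] := wk F0 UF0 oo0.
(* Otherwise some ultrafilter lives on indices with error at least [e]; its weak limit is fixed,
   hence equals [l], a contradiction. *)
exists l => // u; apply/cvgrPdist_lt => e e0; apply: contrapT => freq.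
have [|F [UF FN Fe]] := @ultra_frequently (fun n => e <= `|dot l u - dot (x n) u|).
  by move=> W; apply: freq; apply: filterS W => n /negP; rewrite -ltNge.
have [m fm xm] := wk F UF FN.
have lm := uniq F0 F l m _ _ oo0 FN fl fm xl xm.
have /cvgrPdist_lt/(_ e e0) near_l := xm u.
have [n [/= + lt]] := @filter_ex _ _ (@ultra_proper _ _ UF) _ (filterI Fe near_l).
by rewrite lm leNgt lt.
Unshelve. all: by end_near. Qed.

End Orbit.
End Averaged.

(** * Affine averaged maps *)

Section AffineAveraged.
Context (R : realType) (H : completeNormedModType R).
Context (dot : {dot H for idfun}) (dot_norm : norm_induced_by dot).

Definition affine_map (T : H -> H) :=
  forall u v (t : R), T ((1 - t) *: u + t *: v) = (1 - t) *: T u + t *: T v.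

Lemma affine_convex (C : set H) : affine_set C -> convex_set C.
Proof.
move=> aC u v t; rewrite !inE => Cu Cv.
by rewrite /conv/= addrC; exact: aC.
Qed.

(** The reflection [2 p - c] of [c] through [p] is also in [C], so the inequality holds with both
    signs. *)
Lemma affine_obtuse_orthogonal (C : set H) x p : affine_set C -> C p ->
  (forall c, C c -> dot (x - p) (c - p) <= 0) ->
  forall c, C c -> dot (x - p) (c - p) = 0.
Proof.
move=> aC Cp ob c Cc; apply/eqP; rewrite eq_le ob//=.
have := ob _ (aC p c (-1) Cp Cc).
rewrite (_ : _ *: p + _ - p = - (c - p)); first by rewrite dotNr; lra.
by apply: (dot_inj dot_norm) => w; rewrite !dotE; ring.
Qed.

(** * Iterates of the linear part *)

Section LinearPart.
Context (k : R) (k0 : 0 < k) (T : H -> H) (avgT : averaged k T) (affT : affine_map T).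

Definition linear_part u := T u - T 0.
Local Notation L := linear_part.

Lemma linear_partZ t u : L (t *: u) = t *: L u.
Proof.
have := affT 0 u t; rewrite scaler0 add0r /L => ->.
by apply: (dot_inj dot_norm) => w; rewrite !dotE; ring.
Qed.

Lemma linear_partD u v : L (u + v) = L u + L v.
Proof.
(* [u + v] is the midpoint of [2 u] and [2 v]; homogeneity then removes the factor 2. *)
have := affT (2 *: u) (2 *: v) 2^-1.
rewrite (_ : (1 - 2^-1) *: _ + _ = u + v) => [E|]; last first.
  by apply: (dot_inj dot_norm) => w; rewrite !dotE; field.
have Eu : T (2 *: u) = 2 *: T u - T 0.
  have := linear_partZ 2 u; rewrite /L => /eqP; rewrite subr_eq => /eqP ->.
  by apply: (dot_inj dot_norm) => w; rewrite !dotE; ring.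
have Ev : T (2 *: v) = 2 *: T v - T 0.
  have := linear_partZ 2 v; rewrite /L => /eqP; rewrite subr_eq => /eqP ->.
  by apply: (dot_inj dot_norm) => w; rewrite !dotE; ring.
rewrite /L E Eu Ev.
by apply: (dot_inj dot_norm) => w; rewrite !dotE; field.
Qed.

Lemma linear_partB u v : L (u - v) = T u - T v.
Proof.
rewrite linear_partD -scaleN1r linear_partZ scaleN1r /L.
by apply: (dot_inj dot_norm) => w; rewrite !dotE; ring.
Qed.

Lemma linear_part_averaged : averaged k L.
Proof.
move=> u v; have := avgT u v; congr (_ + k * _ <= _).
- by congr (`|_| ^+ 2); rewrite /L opprB subrKA.
- congr (`|_| ^+ 2); rewrite /L.
  by apply: (dot_inj dot_norm) => w; rewrite !dotE; ring.
Qed.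

Local Notation V := [set w : H | iter n L w @[n --> \oo] --> (0 : H)].

Lemma iter_linear_partD n u v : iter n L (u + v) = iter n L u + iter n L v.
Proof. by elim: n => //= n ->; exact: linear_partD. Qed.

Lemma iter_linear_partZ n t u : iter n L (t *: u) = t *: iter n L u.
Proof. by elim: n => //= n ->; exact: linear_partZ. Qed.

Lemma vanishing_affine : affine_set V.
Proof.
move=> u v t /= Vu Vv; under eq_cvg do rewrite iter_linear_partD !iter_linear_partZ.
have -> : (0 : H) = (1 - t) *: 0 + t *: 0 by rewrite !scaler0 addr0.
by apply: cvgD; apply: cvgZl_tmp.
Qed.

Lemma linear_part0 : L 0 = 0.
Proof. by rewrite /L subrr. Qed.

Lemma iter_linear_part_le n u : `|iter n L u| <= `|u|.
Proof.
elim: n => //= n; apply: le_trans.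
have := averaged_nonexpansive k0 linear_part_averaged (iter n L u) 0.
by rewrite linear_part0 !subr0.
Qed.

(** The iterates of [L] are uniformly nonexpansive, so approximation within [e / 2] by a member of
    [V] suffices. *)
Lemma vanishing_closed : closed V.
Proof.
move=> w clw; apply/cvgr0Pnorm_lt => e e0; have e2 : 0 < e / 2 by rewrite divr_gt0.
have [u [Vu wu]] := clw _ (nbhsx_ballx w (e / 2) e2).
move/cvgr0Pnorm_lt/(_ (e / 2) e2): Vu; apply: filterS => n lt.
rewrite -(subrK u w) iter_linear_partD; apply: le_lt_trans (ler_normD _ _) _.
move: wu; rewrite -ball_normE /= => wu.
by have := iter_linear_part_le n (w - u); lra.
Qed.

(** The iterates of [u - L u] are the steps of the orbit of [u], which vanish because [L] fixes
    0. *)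
Lemma vanishing_step u : V (u - L u).
Proof.
rewrite /= -scaleN1r; under eq_cvg do rewrite iter_linear_partD iter_linear_partZ -iterSr scaleN1r.
have := @gap_cvg0 _ _ _ k0 _ linear_part_averaged (fun n => iter n L u) (fun=> erefl)
  (fun=> 0) (fun=> esym linear_part0).
by under eq_cvg do rewrite subrr subr0.
Qed.

Lemma fixpoints_affine : affine_set (fixpoints T).
Proof. by move=> u v t; rewrite /fixpoints/= => fu fv; rewrite affT fu fv. Qed.

Lemma fixpoints_closed : closed (fixpoints T).
Proof.
move=> w clw; apply/eqP; rewrite -subr_eq0 -normr_eq0 eq_le normr_ge0 andbT.
apply/ler_addgt0Pr => e e0; rewrite add0r; have e2 : 0 < e / 2 by rewrite divr_gt0.
have [u [/= Tu wu]] := clw _ (nbhsx_ballx w (e / 2) e2).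
move: wu; rewrite -ball_normE /= => wu.
rewrite -(subrKA u); apply: le_trans (ler_normD _ _) _.
have := averaged_nonexpansive k0 avgT w u; rewrite Tu (distrC u w); lra.
Qed.

(* [V] is a closed subspace containing the range of [1 - L]. For [w] orthogonal to the fixed
   vectors of [L], the component [r] of [w] orthogonal to [V] satisfies [<r, r - L r> = 0],
   whence [L r = r] by nonexpansiveness, so [<w, r> = 0] and [r = 0]. *)
Lemma orthogonal_fixed_vanishing w : (forall r, L r = r -> dot w r = 0) -> V w.
Proof.
move=> wfix.
have V0 : V !=set0 by exists (0 - L 0); exact: vanishing_step.
have [Vv ob] := projector_spec dot_norm w V0 vanishing_closed (affine_convex vanishing_affine).
set v := projector V w in Vv ob.
have orth s : V s -> dot (w - v) s = 0.
  have ort := affine_obtuse_orthogonal vanishing_affine Vv ob.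
  move=> Vs; have Vvs : V (v + s).
    rewrite /=; under eq_cvg do rewrite iter_linear_partD.
    by rewrite -(addr0 0); exact: cvgD.
  by have := ort _ Vvs; rewrite [v + s]addrC addrK.
have [r rE] : exists r, r = w - v by exists (w - v).
rewrite -rE in orth.
have Lr : L r = r.
  have := orth _ (vanishing_step r); rewrite dotDr dotNr => rLr.
  have := iter_linear_part_le 1 r; rewrite /= (ler_norm_dot dot_norm) => le.
  move: (L r) rLr le => s rLr le.
  apply/eqP; rewrite -subr_eq0; apply/eqP/(dot_eq0 dot_norm)/eqP.
  rewrite eq_le (dot_ge0 dot_norm) andbT !dotE.
  by rewrite (dotC _ s r); lra.
suff /(dot_eq0 dot_norm)/eqP : dot r r = 0 by rewrite rE subr_eq0 => /eqP ->.
by rewrite {1}rE dotDl dotNl (wfix _ Lr) sub0r dotC orth// oppr0.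
Qed.

(** With [f] the projection of [x 0] onto the fixed points, [x n - f] is the [n]-th iterate of [L]
    at [x 0 - f]. That vector is orthogonal to every [r] with [L r = r], since [f + r] is then fixed
    by [T]. *)
Lemma affine_averaged_cvg (x : nat -> H) z : T z = z -> (forall n, x n.+1 = T (x n)) ->
  x @ \oo --> projector (fixpoints T) (x 0).
Proof.
move=> Tz xS.
have F0 : fixpoints T !=set0 by exists z.
have [Tf ob] := projector_spec dot_norm (x 0) F0 fixpoints_closed (affine_convex fixpoints_affine).
have := affine_obtuse_orthogonal fixpoints_affine Tf ob.
set f := projector _ _ in Tf ob * => orth.
have : V (x 0 - f).
  apply: orthogonal_fixed_vanishing => r Lr.
  have := orth (f + r); rewrite addrAC subrr add0r; apply.
  rewrite /fixpoints/=; have := linear_partB (f + r) f.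
  by rewrite addrAC subrr add0r Lr Tf => /eqP; rewrite eq_sym subr_eq addrC => /eqP.
rewrite /=; have xf n : iter n L (x 0 - f) = x n - f.
  by elim: n => //= n ->; rewrite linear_partB Tf xS.
under eq_cvg do rewrite xf.
move=> lim; have : x n - f + f @[n --> \oo] --> 0 + f by apply: cvgD => //; exact: cvg_cst.
by under eq_cvg do rewrite subrK; rewrite add0r.
Qed.

End LinearPart.
End AffineAveraged.

(** * Averaged alternating modified reflections *)

Section Reflections.
Context (R : realType) (H : completeNormedModType R).
Context (dot : {dot H for idfun}) (dot_norm : norm_induced_by dot).

(** Sum of the two obtuse angle inequalities, each tested at the other projection. *)
Lemma projector_firm (C : set H) u v : C !=set0 -> closed C -> convex_set C ->
  `|projector C u - projector C v| ^+ 2 <= dot (u - v) (projector C u - projector C v).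
Proof.
move=> C0 clC cC; have [Cu obu] := projector_spec dot_norm u C0 clC cC.
have [Cv obv] := projector_spec dot_norm v C0 clC cC.
have := obu _ Cv; have := obv _ Cu.
move: (projector C u) (projector C v) => p r; rewrite dot_norm !dotE.
by rewrite (dotC _ r p); lra.
Qed.

(** For [d] the difference of projections and [e = u - v], expand [|2 beta d - e|^2] and use
    [|d|^2 <= <e, d>]. *)
Lemma modified_reflector_contract (C : set H) (beta : R) u v :
  C !=set0 -> closed C -> convex_set C -> 0 < beta ->
  `|modified_reflector C beta u - modified_reflector C beta v| ^+ 2
    + 4 * (beta * (1 - beta)) * `|projector C u - projector C v| ^+ 2 <= `|u - v| ^+ 2.
Proof.
move=> C0 clC cC b0; have := projector_firm u v C0 clC cC; rewrite /modified_reflector.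
move: (projector C u) (projector C v) => p r firm.
rewrite (_ : _ - u - _ = (2 * beta) *: (p - r) - (u - v)); last first.
  by apply: (dot_inj dot_norm) => w; rewrite !dotE; ring.
move: (p - r) (u - v) firm => d e; rewrite !dot_norm !dotE (dotC _ d e) => firm.
by have := ler_wpM2l (ltW b0) firm; lra.
Qed.

(** The surplus of [B] is dropped; that of [A] is kept, as it makes the projections onto [A]
    converge strongly. Averaging uses [|(1 - alpha) d + alpha e|^2 + alpha (1 - alpha) |d - e|^2 =
    (1 - alpha) |d|^2 + alpha |e|^2]. *)
Lemma aamr_contract (A B : set H) (alpha beta : R) u v :
  A !=set0 -> closed A -> convex_set A -> B !=set0 -> closed B -> convex_set B ->
  0 < alpha < 1 -> 0 < beta < 1 ->
  let T := aamr A B alpha beta in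
  `|T u - T v| ^+ 2 + (1 - alpha) / alpha * `|(u - T u) - (v - T v)| ^+ 2
    + 4 * alpha * (beta * (1 - beta)) * `|projector A u - projector A v| ^+ 2
  <= `|u - v| ^+ 2.
Proof.
move=> A0 clA cA B0 clB cB /andP[a0 a1] /andP[b0 b1]; rewrite /aamr /=.
have bb : 0 <= 4 * (beta * (1 - beta)) by rewrite !mulr_ge0 ?subr_ge0 ?ltW.
have := modified_reflector_contract u v A0 clA cA b0.
move: (modified_reflector A beta u) (modified_reflector A beta v) => y z.
have := modified_reflector_contract y z B0 clB cB b0.
move: (modified_reflector B beta y) (modified_reflector B beta z) => s t.
have := mulr_ge0 bb (sqr_ge0 `|projector B y - projector B z|).
move: (_ * _) => m m0 hB; move: (`|projector A u - _| ^+ 2) => P hA.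
have {hB hA m0} st : `|s - t| ^+ 2 + 4 * (beta * (1 - beta)) * P <= `|u - v| ^+ 2 by lra.
rewrite (_ : _ + _ - (_ + _) = (1 - alpha) *: (u - v) + alpha *: (s - t)); last first.
  by apply: (dot_inj dot_norm) => w; rewrite !dotE; ring.
rewrite (_ : u - _ - _ = alpha *: ((u - v) - (s - t))); last first.
  by apply: (dot_inj dot_norm) => w; rewrite !dotE; ring.
move: st; move: (u - v) (s - t) => d e.
rewrite !dot_norm !dotE (dotC _ e d) => /(ler_wpM2l (ltW a0)).
move=> st; apply: (@le_trans _ _ ((1 - alpha) * dot d d
    + alpha * (dot e e + 4 * (beta * (1 - beta)) * P))); last by lra.
by rewrite le_eqVlt; apply/orP; left; apply/eqP; field; rewrite gt_eqF.
Qed.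

Lemma projector_translate (C : set H) q u : C !=set0 -> closed C -> convex_set C ->
  projector (translate C q) u = projector C (q + u) - q.
Proof.
move=> C0 clC cC; have [Cp ob] := projector_spec dot_norm (q + u) C0 clC cC.
apply: (projector_unique dot_norm); first by exists (projector C (q + u)).
move=> _ [c Cc <-]; have := ob c Cc; move: (projector _ _) => p.
congr (dot _ _ <= 0); apply: (dot_inj dot_norm) => w; rewrite !dotE; ring.
Qed.

Lemma translate_nonempty (C : set H) q : C !=set0 -> translate C q !=set0.
Proof. by move=> [c Cc]; exists (c - q), c. Qed.

Lemma translateE (C : set H) q : translate C q = [set u | C (u + q)].
Proof.
apply/seteqP; split=> [_ [c Cc <-]|u /= Cu]; first by rewrite /= subrK.
by exists (u + q) => //; rewrite addrK.
Qed.

Lemma translate_closed (C : set H) q : closed C -> closed (translate C q).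
Proof.
move=> clC; rewrite translateE.
apply: (@preimage_closed _ _ (fun u => u + q)) => // u _.
by apply: cvgD; [exact: cvg_id|exact: cvg_cst].
Qed.

Lemma translate_convex (C : set H) q : convex_set C -> convex_set (translate C q).
Proof.
move=> cC u v t; rewrite !inE translateE /= => Cu Cv.
have /set_mem := cC _ _ t (mem_set Cu) (mem_set Cv).
rewrite /conv/= /unstable.onem; congr C; apply: (dot_inj dot_norm) => w; rewrite !dotE; ring.
Qed.

Lemma translate_affine (C : set H) q : affine_set C -> affine_set (translate C q).
Proof.
move=> aC u v t; rewrite translateE /= => Cu Cv; have := aC _ _ t Cu Cv.
congr C; apply: (dot_inj dot_norm) => w; rewrite !dotE; ring.
Qed.

Lemma normal_cone_projector (C : set H) p u (t : R) : 0 <= t ->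
  normal_cone dot C p u -> projector C (p + t *: u) = p.
Proof.
move=> t0 [Cp nu]; apply: (projector_unique dot_norm) => // c Cc.
by rewrite addrAC subrr add0r dotZl mulr_ge0_le0// nu.
Qed.

(** * Fixed points and the qualification condition *)

Section Fixpoints.
Context (A B : set H) (alpha beta : R) (q : H).
Context (A0 : A !=set0) (clA : closed A) (cA : convex_set A).
Context (B0 : B !=set0) (clB : closed B) (cB : convex_set B).
Context (halpha : 0 < alpha < 1) (hbeta : 0 < beta < 1).
Local Notation T := (aamr (translate A q) (translate B q) alpha beta).

Lemma aamr_fixpointP x : T x = x <->
  modified_reflector (translate B q) beta (modified_reflector (translate A q) beta x) = x.
Proof.
have /andP[a0 _] := halpha.
rewrite /aamr; move: (modified_reflector _ _ (modified_reflector _ _ x)) => s.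
split=> [/eqP|->]; last by rewrite -scalerDl subrK scale1r.
rewrite -subr_eq0 (_ : _ - x = alpha *: (s - x)); last first.
  by apply: (dot_inj dot_norm) => w; rewrite !dotE; ring.
by rewrite scaler_eq0 gt_eqF//= subr_eq0 => /eqP.
Qed.

(** Let [y] be the reflected point [2 beta (p - q) - x]. The fixed point equation says that [q + y]
    projects onto [B] at the same [p], so [q + x - p] and [q + y - p] are normal to [A] and [B] at
    [p]. *)
Lemma fixpoint_qualified x : T x = x -> let p := projector A (q + x) in
  [/\ A p, B p, projector (A `&` B) q = p
    & mink_sum (normal_cone dot A p) (normal_cone dot B p) (q - p)].
Proof.
have /andP[b0 b1] := hbeta.
move=> /aamr_fixpointP; rewrite /modified_reflector !projector_translate//.
have [] := projector_spec dot_norm (q + x) A0 clA cA.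
move: (projector A _) => p Ap obA; have [y yE] : exists y, y = (2 * beta) *: (p - q) - x.
  by exists ((2 * beta) *: (p - q) - x).
rewrite -yE; have [] := projector_spec dot_norm (q + y) B0 clB cB.
move: (projector B _) => b Bp obB /eqP; rewrite subr_eq => /eqP bp.
have {}bp : b = p.
  apply: (addIr (- q)); apply: (scalerI (a := 2 * beta)).
    by rewrite mulf_neq0 ?pnatr_eq0// gt_eqF.
  by rewrite bp yE addrC subrK.
rewrite {}bp in Bp obB.
(* The two normal vectors add up to [2 (1 - beta) (q - p)], hence this rescaling. *)
have c0 : 0 < (2 * (1 - beta))^-1 by rewrite invr_gt0 mulr_gt0// subr_gt0.
have NA : normal_cone dot A p ((2 * (1 - beta))^-1 *: (q + x - p)).
  by split=> // c Ac; rewrite dotZl pmulr_rle0// obA.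
have NB : normal_cone dot B p ((2 * (1 - beta))^-1 *: (q + y - p)).
  by split=> // c Bc; rewrite dotZl pmulr_rle0// obB.
have E : (2 * (1 - beta))^-1 *: (q + x - p) + (2 * (1 - beta))^-1 *: (q + y - p) = q - p.
  have nz : 1 - beta != 0 by rewrite gt_eqF// subr_gt0.
  by apply: (dot_inj dot_norm) => w; rewrite yE !dotE; field.
split=> //; last by exists ((2 * (1 - beta))^-1 *: (q + x - p)) => //;
  exists ((2 * (1 - beta))^-1 *: (q + y - p)).
apply: (projector_unique dot_norm) => // c [Ac Bc].
by rewrite -E dotDl -(addr0 0) lerD ?NA.2 ?NB.2.
Qed.

Lemma qualified_fixpoint p :
  mink_sum (normal_cone dot A p) (normal_cone dot B p) (q - p) -> exists x, T x = x.
Proof.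
have /andP[b0 b1] := hbeta; have c0 : 0 <= 2 * (1 - beta) by rewrite mulr_ge0// subr_ge0 ltW.
(* Reflecting this point in [A - q] replaces [u] by [v], because [u + v = q - p]; reflecting in
   [B - q] replaces [v] by [u] again. *)
move=> [u Nu [v Nv uv]]; exists (p - q + (2 * (1 - beta)) *: u); apply/aamr_fixpointP.
rewrite /modified_reflector !projector_translate//.
rewrite (_ : q + (p - q + _) = p + (2 * (1 - beta)) *: u); last first.
  by apply: (dot_inj dot_norm) => w; rewrite !dotE; ring.
rewrite normal_cone_projector//.
have -> : q = p + u + v by rewrite -addrA uv addrC subrK.
rewrite (_ : p + u + v + _ = p + (2 * (1 - beta)) *: v); last first.
  by apply: (dot_inj dot_norm) => w; rewrite !dotE; ring.
rewrite normal_cone_projector//.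
by apply: (dot_inj dot_norm) => w; rewrite !dotE; ring.
Qed.

End Fixpoints.

(** The residual of the combined point is the same combination of [u - p] and [v - r], both
    orthogonal to all directions of [C]. *)
Lemma projector_affine (C : set H) : C !=set0 -> closed C -> affine_set C ->
  affine_map (projector C).
Proof.
move=> C0 clC aC u v t; have cC := affine_convex aC.
have [Cu obu] := projector_spec dot_norm u C0 clC cC.
have [Cv obv] := projector_spec dot_norm v C0 clC cC.
apply: (projector_unique dot_norm); first exact: aC.
have {}obu := affine_obtuse_orthogonal dot_norm aC Cu obu.
have {}obv := affine_obtuse_orthogonal dot_norm aC Cv obv.
move: (projector C u) (projector C v) Cu Cv obu obv => p r Cp Cr obu obv c Cc.
have [m mE] : exists m, m = (1 - t) *: p + t *: r by exists ((1 - t) *: p + t *: r).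
have Cm : C m by rewrite mE; exact: aC.
have ucm : dot (u - p) (c - m) = 0.
  have -> : c - m = (c - p) - (m - p) by rewrite opprB addrA subrK.
  by rewrite dotDr dotNr obu// obu// subrr.
have vcm : dot (v - r) (c - m) = 0.
  have -> : c - m = (c - r) - (m - r) by rewrite opprB addrA subrK.
  by rewrite dotDr dotNr obv// obv// subrr.
rewrite -mE (_ : _ - m = (1 - t) *: (u - p) + t *: (v - r)).
  by rewrite dotDl !dotZl ucm vcm !mulr0 addr0.
by apply: (dot_inj dot_norm) => w; rewrite mE !dotE; ring.
Qed.

End Reflections.

Lemma aamr_affine (R : realType) (H : completeNormedModType R) (dot : {dot H for idfun})
    (A B : set H) (alpha beta : R) : norm_induced_by dot ->
  A !=set0 -> closed A -> affine_set A -> B !=set0 -> closed B -> affine_set B ->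
  affine_map (aamr A B alpha beta).
Proof.
move=> dot_norm A0 clA aA B0 clB aB u v t.
have refl_affine (C : set H) : C !=set0 -> closed C -> affine_set C ->
    affine_map (modified_reflector C beta).
  move=> C0 clC aC y z s; rewrite /modified_reflector (projector_affine dot_norm C0 clC aC).
  by apply: (dot_inj dot_norm) => w; rewrite !dotE; ring.
rewrite /aamr (refl_affine A)// (refl_affine B)//.
by apply: (dot_inj dot_norm) => w; rewrite !dotE; ring.
Qed.

(** * Dichotomy and strong convergence for AAMR orbits *)

Theorem theorem4p1 (R : realType) (H : completeNormedModType R)
    (dot : {dot H for idfun}) (dot_norm : norm_induced_by dot)
    (A B : set H)
    (A0 : A !=set0) (clA : closed A) (cvxA : convex_set A)
    (B0 : B !=set0) (clB : closed B) (cvxB : convex_set B)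
    (alpha beta : R) (halpha : 0 < alpha < 1) (hbeta : 0 < beta < 1)
    (q x0 : H) (x : nat -> H) (x_init : x 0%N = x0)
    (x_rec : forall n : nat,
      x n.+1 = aamr (translate A q) (translate B q) alpha beta (x n)) :
  let T := aamr (translate A q) (translate B q) alpha beta in
  let p := projector (A `&` B) q in
  let qualified := A `&` B !=set0 /\
    mink_sum (normal_cone dot A p) (normal_cone dot B p) (q - p) in
  [/\ qualified ->
        [/\ exists2 xstar : H, weakly_cvg dot x xstar
              & fixpoints T xstar /\ projector A (q + xstar) = p,
            x n.+1 - x n @[n --> \oo] --> (0 : H)
          & projector A (q + x n) @[n --> \oo] --> p],
      ~ qualified -> `|x n| @[n --> \oo] --> +oo
    & affine_set A -> affine_set B -> A `&` B !=set0 ->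
        mink_sum (orthogonal_complement dot (mink_diff A A))
                 (orthogonal_complement dot (mink_diff B B)) (q - p) ->
        x n @[n --> \oo] --> projector (fixpoints T) x0].
Proof.
move=> T p qualified.
have [/andP[a0 a1] /andP[b0 b1]] := (halpha, hbeta).
have A'0 := translate_nonempty q A0; have B'0 := translate_nonempty q B0.
have clA' := translate_closed (q := q) clA; have clB' := translate_closed (q := q) clB.
have cA' := translate_convex dot_norm (q := q) cvxA.
have cB' := translate_convex dot_norm (q := q) cvxB.
have k0 : 0 < (1 - alpha) / alpha by rewrite divr_gt0// subr_gt0.
have m0 : 0 < 4 * alpha * (beta * (1 - beta)) by rewrite !mulr_gt0// subr_gt0.
have contract u v := aamr_contract dot_norm u v A'0 clA' cA' B'0 clB' cB' halpha hbeta.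
have avgT : averaged ((1 - alpha) / alpha) T.
  move=> u v; apply: le_trans (contract u v); rewrite lerDl.
  by rewrite mulr_ge0 ?sqr_ge0 ?(ltW m0).
(* The intersection is not yet known to be nonempty, so [p] could be the default 0; a fixed point
   supplies a common point and identifies [p]. *)
have fixed_qualified z : T z = z -> projector A (q + z) = p /\ qualified.
  move=> Tz; have [Ap Bp pE mp] :=
    fixpoint_qualified dot_norm A0 clA cvxA B0 clB cvxB halpha hbeta Tz.
  by rewrite /qualified /p pE; split=> //; split=> //; exists (projector A (q + z)).
have qualified_fixed : qualified -> exists z, T z = z.
  move=> [_ mp]; exact: (qualified_fixpoint dot_norm A0 clA cvxA B0 clB cvxB halpha hbeta mp).
split=> [Q|NQ|aA aB AB0 [u uA [v vB uv]]].
- have [z Tz] := qualified_fixed Q.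
  have [cz reg] := averaged_fejer k0 avgT x_rec Tz.
  split.
  + have [l Tl xl] := averaged_weak_cvg dot_norm k0 avgT x_rec Tz.
    by exists l => //; split=> //; have [] := fixed_qualified l Tl.
  + have : - (x n - x n.+1) @[n --> \oo] --> - (0 : H) by exact: cvgN.
    by rewrite oppr0; under eq_cvg do rewrite opprB.
  (* Once [p] is written as the projection of [q + z], the surplus of [A] bounds
     [|P_A (q + x n) - p|^2] by a multiple of the decrease of [|x n - z|^2]. *)
  + have [<- _] := fixed_qualified z Tz.
    apply/subr_cvg0.
    apply: (decrement_norm_cvg0 (a := fun n => `|x n - z| ^+ 2) m0) => n; first exact: sqr_ge0.
    have := contract (x n) z; rewrite /= -/T Tz subrr subr0 !(projector_translate dot_norm)//.
    rewrite opprB subrKA x_rec; apply: le_trans; rewrite lerD2r lerDl.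
    by rewrite mulr_ge0 ?sqr_ge0 ?(ltW k0).
- apply: (averaged_fixed_or_escape dot_norm k0 avgT x_rec) => z Tz.
  by apply: NQ; have [] := fixed_qualified z Tz.
have clAB : closed (A `&` B) by exact: closedI.
have [[Ap Bp] _] : (A `&` B) p /\ forall c, (A `&` B) c -> dot (q - p) (c - p) <= 0.
  apply: (projector_spec dot_norm) => //; apply: affine_convex.
  by move=> y z t [Ay By] [Az Bz]; split; [exact: aA|exact: aB].
(* For [c] in [A] the vector [c - p] lies in [A - A], so [u] is normal to [A] at [p]; likewise [v]
   for [B]. *)
have [z Tz] : exists z, T z = z.
  apply: qualified_fixed; split=> //; exists u; last (exists v => //).
    by split=> // c Ac; rewrite dotC uA//; exists c => //; exists p.
  by split=> // c Bc; rewrite dotC vB//; exists c => //; exists p.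
rewrite -x_init.
apply: (affine_averaged_cvg dot_norm k0 avgT _ Tz x_rec).
exact: (aamr_affine _ _ dot_norm A'0 clA' (translate_affine dot_norm aA)
  B'0 clB' (translate_affine dot_norm aB)).
Qed.
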